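(* Let $P$ be a separative poset. Then all separative fusion-completions and all separative sum-completions of $P$ are isomorphic to each other; that is, if each of $(M,e)$ and $(M',e')$ is a separative fusion-completion or a separative sum-completion of $P$, then there is an order-isomorphism $h\colon M\to M'$ with $h\circ e=e'$.
   Context: In a poset $P$, two elements $x,y$ overlap, written $x\circ y$, if there is $z\in P$ with $z\le x$ and $z\le y$; they are disjoint, written $x\wr y$, if they do not overlap. A poset $P$ is separative if whenever $x\not\le y$ there is $z\le x$ with $z\wr y$. A map $f\colon P\to M$ of posets is an order-embedding if $x\le y\iff f(x)\le f(y)$. Let $\varnothing\ne A\subseteq P$ and $x\in P$. The element $x$ is a fusion of $A$ if for every $y\in P$: $y\circ x$ if and only if $y\circ z$ for some $z\in A$. The element $x$ is a sum of $A$ if $a\le x$ for all $a\in A$ and for every $y\le x$ there is $z\in A$ with $y\circ z$. A poset is fusion-complete (resp. sum-complete) if every nonempty subset has a fusion (resp. a sum). A map $f\colon P\to M$ is: $\circ$-reflecting if $f(x)\circ f(y)$ implies $x\circ y$; fusion-preserving if $f(x)$ is a fusion of $f(A)$ in $M$ whenever $x\in P$ is a fusion of $A\subseteq P$; fusion-dense (resp. sum-dense) if for every $m\in M$ there is $A\subseteq P$ such that $m$ is a fusion (resp. a sum) of $f(A)$ in $M$. A fusion-completion of $P$ is a pair $(M,e)$ where $M$ is a fusion-complete poset and $e\colon P\to M$ is a $\circ$-reflecting, fusion-preserving and fusion-dense order-embedding. A sum-completion of $P$ is a pair $(M,e)$ where $M$ is a sum-complete poset and $e\colon P\to M$ is a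 sum-dense order-embedding. A fusion- or sum-completion $(M,e)$ is called separative if $M$ is separative. *)

(* Defs.v *)
From HB Require Import structures.
From mathcomp Require Import all_boot all_order.
From mathcomp Require Import boolp classical_sets.

Set Implicit Arguments.
Unset Strict Implicit.
Unset Printing Implicit Defensive.

Local Open Scope classical_set_scope.
Local Open Scope order_scope.

Section Poset.
Context {d : Order.disp_t} {P : porderType d}.
Implicit Types (x y z a : P) (A : set P).

Definition overlap x y : Prop := exists z, z <= x /\ z <= y.

Definition disjoint_elt x y : Prop := ~ overlap x y.

Definition is_fusion A x : Prop :=
  A !=set0 /\
  forall y, overlap y x <-> exists z, A z /\ overlap y z.

Definition is_sum A x : Prop :=
  [/\ A !=set0,
      forall a, A a -> a <= x &
      forall y, y <= x -> exists z, A z /\ overlap y z].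

End Poset.

Section PosetClasses.
Context {d : Order.disp_t} (P : porderType d).

Definition separative : Prop :=
  forall x y : P, ~ (x <= y) -> exists z, z <= x /\ disjoint_elt z y.

Definition fusion_complete : Prop :=
  forall A : set P, A !=set0 -> exists x, is_fusion A x.

Definition sum_complete : Prop :=
  forall A : set P, A !=set0 -> exists x, is_sum A x.

End PosetClasses.

Section Maps.
Context {d d' : Order.disp_t} {P : porderType d} {M : porderType d'}.
Variable f : P -> M.

Definition order_embedding : Prop := {mono f : x y / x <= y}.

Definition order_isomorphism : Prop := bijective f /\ order_embedding.

Definition overlap_reflecting : Prop :=
  forall x y, overlap (f x) (f y) -> overlap x y.

Definition fusion_preserving : Prop :=
  forall (A : set P) x, is_fusion A x -> is_fusion (f @` A) (f x).

Definition fusion_dense : Prop :=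
  forall m, exists A : set P, is_fusion (f @` A) m.

Definition sum_dense : Prop :=
  forall m, exists A : set P, is_sum (f @` A) m.

Definition fusion_completion : Prop :=
  [/\ fusion_complete M, order_embedding, overlap_reflecting,
      fusion_preserving & fusion_dense].

Definition sum_completion : Prop :=
  [/\ sum_complete M, order_embedding & sum_dense].

Definition separative_fusion_completion : Prop :=
  fusion_completion /\ separative M.

Definition separative_sum_completion : Prop :=
  sum_completion /\ separative M.

End Maps.

(* Main.v *)
Require Import Defs.
From HB Require Import structures.
From mathcomp Require Import all_boot all_order.
From mathcomp Require Import boolp classical_sets.

(** In a separative poset fusions and sums coincide, so a separative
    fusion-completion is a separative sum-completion, and it is enough to
    compare two of the latter.

    Let [e : P -> M] be a separative sum-completion.  By sum-density an element
    [m] of [M] is determined by its trace [{p | e p <= m}], and the order of [M]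
    is inclusion of traces ([trace_le]).  If [m] is a sum of [e @` A], its trace
    is the set of those [p] all of whose minorants overlap some element of [A]
    ([trace_of_sum]).  This description mentions only [P] and [A]; by density
    and sum-completeness, the traces are exactly the sets of this form with [A]
    nonempty.  Hence two separative sum-completions have the same traces, and
    matching elements with equal traces is the required isomorphism; it carries
    [e p] to [e' p] because both have as trace the principal down-set of [p]. *)

Import Order.Theory.
Local Open Scope classical_set_scope.
Local Open Scope order_scope.

Lemma le_overlap {d : Order.disp_t} {P : porderType d} (x y : P) :
  x <= y -> overlap x y.
Proof. by move=> xy; exists x. Qed.

(** In a separative poset, [x <= y] as soon as every minorant of [x] overlaps
    [y]. *)
Lemma separative_le {d : Order.disp_t} {P : porderType d} (x y : P) :
  separative P -> (forall z, z <= x -> overlap z y) -> x <= y.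
Proof.
move=> sepP zy; apply: contrapT => /sepP[z [zx]].
by apply; exact: zy.
Qed.

Lemma separative_fusion_sum {d : Order.disp_t} {P : porderType d}
    (A : set P) (x : P) :
  separative P -> is_fusion A x -> is_sum A x.
Proof.
move=> sepP [A0 fusA]; split=> // [a Aa|y yx].
  apply: separative_le => // z za; apply/fusA.
  by exists a; split=> //; exact: le_overlap.
by apply/fusA; exact: le_overlap.
Qed.

Lemma separative_fusion_completion_sum {d d' : Order.disp_t}
    {P : porderType d} {M : porderType d'} (e : P -> M) :
  separative_fusion_completion e -> separative_sum_completion e.
Proof.
move=> [[compM emb_e _ _ dense_e] sepM]; split=> //; split=> // [A A0|m].
  by have [x xA] := compM _ A0; exists x; exact: separative_fusion_sum.
by have [A mA] := dense_e m; exists A; exact: separative_fusion_sum.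
Qed.

Lemma sum_dense_below {d d' : Order.disp_t}
    {P : porderType d} {M : porderType d'} (e : P -> M) (m : M) :
  sum_dense e -> exists p, e p <= m.
Proof.
move=> /(_ m)[A [[_ [p Ap _]] ub _]].
by exists p; apply: ub; exists p.
Qed.

Lemma sum_dense_overlap_reflecting {d d' : Order.disp_t}
    {P : porderType d} {M : porderType d'} (e : P -> M) :
  order_embedding e -> sum_dense e -> overlap_reflecting e.
Proof.
move=> emb_e dense_e x y [m [mx my]].
have [p pm] := sum_dense_below e m dense_e.
by exists p; split; rewrite -emb_e; exact: le_trans pm _.
Qed.

(** The order of a separative poset containing [P] as a sum-dense subposet is
    inclusion of traces on [P]. *)
Lemma trace_le {d d' : Order.disp_t}
    {P : porderType d} {M : porderType d'} (e : P -> M) (m n : M) :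
  separative M -> sum_dense e ->
  (forall p, e p <= m -> e p <= n) -> m <= n.
Proof.
move=> sepM dense_e mn; apply: separative_le => // z zm.
have [p pz] := sum_dense_below e z dense_e.
by exists (e p); split=> //; apply/mn/(le_trans pz).
Qed.

(** The trace of a sum of [e @` A] depends only on [P] and [A]. *)
Lemma trace_of_sum {d d' : Order.disp_t}
    {P : porderType d} {M : porderType d'} (e : P -> M) (A : set P) (m : M) :
  separative M -> order_embedding e -> sum_dense e -> is_sum (e @` A) m ->
  forall p, e p <= m <->
    forall q, q <= p -> exists a, A a /\ overlap q a.
Proof.
move=> sepM emb_e dense_e [_ ub sumA] p; split=> [pm q qp|pA].
  have [|_ [[a Aa <-] qa]] := sumA (e q).
    by apply: le_trans pm; rewrite emb_e.
  by exists a; split=> //; exact: sum_dense_overlap_reflecting qa.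
apply: separative_le => // z zp.
have [q qz] := sum_dense_below e z dense_e.
have [|a [Aa [r [rq ra]]]] := pA q.
  by rewrite -emb_e; exact: le_trans zp.
exists (e r); split; first by apply: le_trans qz; rewrite emb_e.
by apply: (@le_trans _ _ (e a)); [rewrite emb_e | apply: ub; exists a].
Qed.

Lemma trace_transfer {d d1 d2 : Order.disp_t}
    {P : porderType d} {M : porderType d1} {M' : porderType d2}
    (e : P -> M) (e' : P -> M') :
  separative_sum_completion e -> separative_sum_completion e' ->
  forall m, exists m', forall p, e' p <= m' <-> e p <= m.
Proof.
move=> [[_ emb_e dense_e] sepM] [[compM' emb_e' dense_e'] sepM'] m.
have [A mA] := dense_e m.
have [|m' m'A] := compM' (e' @` A).
  by have [[_ [a Aa _]] _ _] := mA; exists (e' a); exists a.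
exists m' => p.
by rewrite (trace_of_sum e' A m') // (trace_of_sum e A m).
Qed.

Theorem theorem4p1 (d d1 d2 : Order.disp_t)
    (P : porderType d) (M : porderType d1) (M' : porderType d2)
    (e : P -> M) (e' : P -> M') :
  separative P ->
  separative_fusion_completion e \/ separative_sum_completion e ->
  separative_fusion_completion e' \/ separative_sum_completion e' ->
  exists h : M -> M', order_isomorphism h /\ h \o e = e'.
Proof.
move=> _ ce ce'.
have {ce} se : separative_sum_completion e.
  by case: ce => // /separative_fusion_completion_sum.
have {ce'} se' : separative_sum_completion e'.
  by case: ce' => // /separative_fusion_completion_sum.
have [h hP] := choice (trace_transfer e e' se se').
have [g gP] := choice (trace_transfer e' e se' se).
have [[_ emb_e dense_e] sepM] := se.
have [[_ emb_e' dense_e'] sepM'] := se'.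
exists h; split; [split|].
- exists g => x; apply/le_anti/andP; split; apply: trace_le => // p.
  + by move=> /gP /hP.
  + by move=> px; apply/gP/hP.
  + by move=> /hP /gP.
  + by move=> px; apply/hP/gP.
- move=> x y; apply/idP/idP => xy; apply: trace_le => // p.
    by move=> px; apply/hP; apply: le_trans xy; apply/hP.
  by move=> /hP px; apply/hP; exact: le_trans xy.
- apply/funext => q /=; apply/le_anti/andP; split; apply: trace_le => // p.
    by move=> /hP; rewrite emb_e emb_e'.
  by rewrite emb_e' => pq; apply/hP; rewrite emb_e.
Qed.
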